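(* Let $n,\theta\geq1$ be given integers and set $N=6\lceil\log(n+1)\rceil\theta$. Then there is a surjection $G\colon\{0,1\}^N\to\mathbb{N}^n|_{\leq\theta}$ such that: (i) for every polynomial $p\colon\mathbb{R}^N\to\mathbb{R}$, the mapping $v\mapsto\mathbb{E}_{x\in G^{-1}(v)}\,p(x)$ (uniform expectation over the preimage) is a polynomial on $\mathbb{N}^n|_{\leq\theta}$ of degree at most $(\deg p)/\lceil\log(n+1)+1\rceil$; (ii) for every coordinate $i=1,2,\dots,n$, the mapping $x\mapsto\mathrm{OR}^*_\theta(G(x)_i)$ is computable by an explicitly given DNF formula with $O(\theta n^6)$ terms, each with at most $6\lceil\log(n+1)\rceil$ variables.
   Context: $\mathbb{N}=\{0,1,2,\dots\}$. For $x\in\mathbb{N}^n$, $|x|=\sum_i x_i$, and $\mathbb{N}^n|_{\le\theta}=\{x\in\mathbb{N}^n:|x|\le\theta\}$. $\mathrm{OR}^*_\theta\colon\{0,1,\dots,\theta\}\to\{0,1\}$ is given by $\mathrm{OR}^*_\theta(0)=0$ and $\mathrm{OR}^*_\theta(t)=1$ for $t\ge1$. Logarithms are base 2. *)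

(* Defs.v *)
From HB Require Import structures.
From mathcomp Require Import all_boot all_order all_algebra.
From mathcomp Require Import mpoly.
From mathcomp Require Import reals.
From mathcomp Require exp.

Set Implicit Arguments.
Unset Strict Implicit.
Unset Printing Implicit Defensive.

Import Order.TTheory GRing.Theory Num.Theory.

(* ceil (log_2 k) for k >= 1: [up_log 2 k] is the least e with k <= 2 ^ e. *)
Notation clog2 k := (up_log 2 k).

Lemma ceil_log2E (R : realType) (k : nat) : 0 < k ->
  Num.ceil (exp.ln (k%:R : R) / exp.ln 2%:R)%R = Posz (clog2 k).
Proof.
move=> k_gt0; have ln2_gt0 : (0 < exp.ln (2%:R : R))%R.
  by apply: exp.ln_gt0; rewrite ltr1n.
have lnX (e : nat) : exp.ln ((2 ^ e)%:R : R) = (e%:R * exp.ln 2%:R)%R.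
  by rewrite natrX exp.lnXn ?ltr0n // mulr_natl.
have X_gt0 (e : nat) : (0 < (2 ^ e)%:R :> R)%R by rewrite ltr0n expn_gt0.
have kR_gt0 : (0 < k%:R :> R)%R by rewrite ltr0n.
apply/eqP; rewrite ceil_eq ler_pdivrMr // ltr_pdivlMr //.
apply/andP; split; last first.
  by rewrite -[_%:~R%R]/(_%:R)%R -lnX exp.ler_ln ?posrE ?ler_nat ?up_logP.
have [k_gt1|k_le1] := ltnP 1 k; last first.
  have -> : k = 1 by apply/eqP; rewrite eqn_leq k_le1.
  by rewrite up_log1 exp.ln1 sub0r mulN1r oppr_lt0.
have e_gt0 : 0 < clog2 k by rewrite up_log_gt0.
rewrite -[X in Posz X](prednK e_gt0) intS addrC addKr.
by rewrite -[_%:~R%R]/(_%:R)%R -lnX exp.ltr_ln ?posrE ?ltr_nat ?up_log_gtn.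
Qed.

Lemma ceil_log2D1E (R : realType) (k : nat) : 0 < k ->
  Num.ceil (exp.ln (k%:R : R) / exp.ln 2%:R + 1)%R = Posz (clog2 k + 1).
Proof. by move=> k_gt0; rewrite ceilDrz ?rpred1 // ceil_log2E // ceil1. Qed.

Definition inputlen (n theta : nat) : nat := 6 * clog2 n.+1 * theta.

Definition cube (N : nat) := {ffun 'I_N -> bool}.

Definition weight (n : nat) (v : {ffun 'I_n -> nat}) : nat := \sum_i v i.

(* The set of v in N^n with |v| <= theta. *)
Definition simplex (n theta : nat) :=
  {v : {ffun 'I_n -> nat} | weight v <= theta}.

(* OR*_theta is the restriction of this function to {0, .., theta}. *)
Definition ORstar (t : nat) : bool := t != 0.

(* 0 for the zero polynomial. *)
Definition tdeg (R : realType) (n : nat) (p : {mpoly R[n]}) : nat := (msize p).-1.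

Definition bool_eval (R : realType) (N : nat) (p : {mpoly R[N]}) (x : cube N) : R :=
  p.@[fun i => (x i)%:R]%R.

Definition nat_eval (R : realType) (n : nat) (q : {mpoly R[n]})
    (v : {ffun 'I_n -> nat}) : R :=
  q.@[fun i => (v i)%:R]%R.

(* Expectation of f(x) for x uniform in the preimage of v under G. *)
Definition fiber_mean (R : realType) (N : nat) (T : eqType) (G : cube N -> T)
    (f : cube N -> R) (v : T) : R :=
  ((\sum_(x | G x == v) f x) / #|[pred x | G x == v]|%:R)%R.

(* A term is a conjunction of literals: variable j is absent from t when
   t j = None, occurs unnegated when t j = Some true, and negated when
   t j = Some false. *)
Definition term (N : nat) := {ffun 'I_N -> option bool}.

Definition dnf (N : nat) := seq (term N).

Definition term_eval (N : nat) (t : term N) (x : cube N) : bool :=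
  [forall j, if t j is Some b then x j == b else true].

Definition dnf_eval (N : nat) (D : dnf N) (x : cube N) : bool :=
  has (fun t => term_eval t x) D.

Definition term_vars (N : nat) (t : term N) : {set 'I_N} :=
  [set j | t j != None].

(* Primitive recursive functions. Arities are not tracked: a program is run on
   a list of arguments, missing arguments being read as 0. *)
Inductive primrec : Type :=
| PZero
| PSucc
| PProj of nat
| PComp of primrec & seq primrec
| PRec of primrec & primrec.

Fixpoint pr_eval (f : primrec) (a : seq nat) {struct f} : nat :=
  match f with
  | PZero => 0
  | PSucc => (head 0 a).+1
  | PProj k => nth 0 a k
  | PComp g hs => pr_eval g (map (fun h => pr_eval h a) hs)
  | PRec g h =>
      nat_rect (fun _ => nat) (pr_eval g (behead a))
        (fun k r => pr_eval h [:: k, r & behead a]) (head 0 a)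
  end.

Definition literal_of_code (c : nat) : option bool :=
  if c is c'.+1 then Some (c' != 0) else None.

(* "Explicitly given", for a family of DNF formulas indexed by n, theta and a
   coordinate i: two primitive recursive programs, not depending on n, theta
   and i, output respectively the number of terms of the formula and the
   occurrence (absent, negated or unnegated) of the j-th variable in its k-th
   term. *)
Definition explicitly_given
    (D : forall n theta : nat, 'I_n -> dnf (inputlen n theta)) : Prop :=
  exists size_prog lit_prog : primrec,
  forall (n theta : nat) (i : 'I_n),
    D n theta i =
      mkseq (fun k => [ffun j : 'I_(inputlen n theta) =>
               literal_of_code
                 (pr_eval lit_prog [:: n; theta; val i; k; val j])])
            (pr_eval size_prog [:: n; theta; val i]).

(* Main.v *)
(* Let L = ceil (log (n + 1)) and cut the input into theta blocks of 6L bits. By a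
   first-moment argument there is an L x 6L binary matrix all of whose nonzero row
   combinations have weight greater than L; the least code of such a matrix is found
   by bounded, hence primitive recursive, search. The syndrome of a block, read as a
   number, is its label t in {0, .., n} (0 if the number exceeds n), standing for the
   zero vector or for a unit vector, and G adds up the vectors of the blocks.

   By Fourier expansion a monomial of degree at most L in one block has the same mean
   on all the fibers of the labelling. So in the mean of a monomial of degree d over
   G^-1(v) at most d / (L + 1) blocks contribute a factor depending on their label,
   and the mean of a product of k functions of labels over the arrangements of v is a
   polynomial in v of degree at most k.

   Finally G(x)_i is nonzero iff some block has label i, which is a disjunction over
   the blocks and over the at most (2n)^6 words with that label. *)
Require Import Defs.
From mathcomp Require Import all_boot all_order all_algebra.
From mathcomp Require Import perm mpoly reals.

Set Implicit Arguments.
Unset Strict Implicit.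
Unset Printing Implicit Defensive.

Import Order.TTheory GRing.Theory Num.Theory.

(** * Primitive recursive functions *)

(* The arity [n] is fixed because [PRec] passes on its whole argument list,
   which a program can only rebuild by listing the projections. *)
Definition primrec_fun (n : nat) (f : seq nat -> nat) : Prop :=
  exists P, forall a, size a = n -> pr_eval P a = f a.

Lemma primrec_ext n f g : (forall a, size a = n -> f a = g a) ->
  primrec_fun n f -> primrec_fun n g.
Proof. by move=> fg [P hP]; exists P => a sa; rewrite hP ?fg. Qed.

Lemma primrec_nth n k : primrec_fun n (fun a => nth 0 a k).
Proof. by exists (PProj k). Qed.

(** Weakening under a bound variable: in sums and searches the index is prepended to the argument
    list. *)
Lemma primrec_behead n f : primrec_fun n f ->
  primrec_fun n.+1 (fun a => f (behead a)).
Proof.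
move=> [F hF]; exists (PComp F [seq PProj i | i <- iota 1 n]) => -[|x l] // [sl].
rewrite /= -map_comp.
have -> : [seq ((pr_eval^~ (x :: l)) \o [eta PProj]) i | i <- iota 1 n] = l.
  by rewrite (iotaDl 1 0) -map_comp -[RHS](mkseq_nth 0) sl.
exact: hF.
Qed.

Lemma primrec_comp n g (hs : seq (seq nat -> nat)) :
  primrec_fun (size hs) g -> (forall i, primrec_fun n (nth (fun=> 0) hs i)) ->
  primrec_fun n (fun a => g [seq h a | h <- hs]).
Proof.
move=> [P hP] Hhs.
have [Qs hQs] : exists Qs, forall a, size a = n ->
    [seq pr_eval Q a | Q <- Qs] = [seq h a | h <- hs].
  elim: hs Hhs {hP} => [|h hs IH] H; first by exists [::].
  have [Qs hQs] := IH (fun i => H i.+1).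
  have [Q hQ] := H 0; exists (Q :: Qs) => a sa /=.
  by rewrite hQ // hQs.
by exists (PComp P Qs) => a sa /=; rewrite hQs // hP // size_map.
Qed.

Lemma primrec_comp1 n (F : nat -> nat) g :
  primrec_fun 1 (fun a => F (nth 0 a 0)) -> primrec_fun n g ->
  primrec_fun n (fun a => F (g a)).
Proof.
move=> HF Hg; apply: (@primrec_comp n _ [:: g] HF) => -[|[|i]] //=; by exists PZero.
Qed.

Lemma primrec_comp2 n (F : nat -> nat -> nat) g1 g2 :
  primrec_fun 2 (fun a => F (nth 0 a 0) (nth 0 a 1)) ->
  primrec_fun n g1 -> primrec_fun n g2 ->
  primrec_fun n (fun a => F (g1 a) (g2 a)).
Proof.
move=> HF H1 H2.
by apply: (@primrec_comp n _ [:: g1; g2] HF) => -[|[|[|i]]] //=; exists PZero.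
Qed.

Lemma primrec_rec n f g c :
  primrec_fun n f ->
  primrec_fun n.+2 (fun l => g (nth 0 l 0) (nth 0 l 1) (behead (behead l))) ->
  primrec_fun n c ->
  primrec_fun n (fun a =>
    nat_rect (fun=> nat) (f a) (fun k r => g k r a) (c a)).
Proof.
move=> [F hF] [G hG] [C hC].
exists (PComp (PRec F G) (C :: [seq PProj i | i <- iota 0 n])) => a sa /=.
rewrite -map_comp /= hC //.
have -> : [seq ((pr_eval^~ a) \o [eta PProj]) i | i <- iota 0 n] = a.
  by rewrite -[RHS](mkseq_nth 0) sa.
rewrite hF //; elim: (c a) => //= k ->.
by rewrite hG /= ?sa.
Qed.

Lemma primrec_cst n k : primrec_fun n (fun=> k).
Proof.
elim: k => [|k [P hP]]; first by exists PZero.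
by exists (PComp PSucc [:: P]) => a sa /=; rewrite hP.
Qed.

Lemma primrec_S n f : primrec_fun n f -> primrec_fun n (fun a => (f a).+1).
Proof. by apply: primrec_comp1; exists PSucc => -[|x []]. Qed.

Lemma primrec_add n f g : primrec_fun n f -> primrec_fun n g ->
  primrec_fun n (fun a => f a + g a).
Proof.
move=> Hf Hg.
have := @primrec_rec n f (fun _ r _ => r.+1) g Hf (primrec_S (primrec_nth _ _)) Hg.
by apply: primrec_ext => a _; rewrite addnC; elim: (g a) => //= k ->.
Qed.

Lemma primrec_mul n f g : primrec_fun n f -> primrec_fun n g ->
  primrec_fun n (fun a => f a * g a).
Proof.
apply: primrec_comp2.
have := @primrec_rec 2 _ (fun _ r a => r + nth 0 a 0) _ (primrec_cst _ 0)
  (primrec_add (primrec_nth _ 1) (primrec_behead (primrec_behead (primrec_nth 2 0))))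
  (primrec_nth _ 1).
case=> P hP; exists P => -[|x [|y []]] // /hP -> /=.
by elim: y => [|y /= ->]; rewrite ?muln0 // mulnS addnC.
Qed.

Lemma primrec_pred n f : primrec_fun n f -> primrec_fun n (fun a => (f a).-1).
Proof.
move=> Hf.
have := @primrec_rec n _ (fun k _ _ => k) f (primrec_cst _ 0) (primrec_nth _ _) Hf.
by apply: primrec_ext => a _; case: (f a).
Qed.

Lemma primrec_sub n f g : primrec_fun n f -> primrec_fun n g ->
  primrec_fun n (fun a => f a - g a).
Proof.
move=> Hf Hg.
have := @primrec_rec n f (fun _ r _ => r.-1) g Hf (primrec_pred (primrec_nth _ _)) Hg.
by apply: primrec_ext => a _; elim: (g a) => [|k /= ->]; rewrite ?subn0 // subnS.
Qed.

Lemma primrec_exp n f g : primrec_fun n f -> primrec_fun n g ->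
  primrec_fun n (fun a => f a ^ g a).
Proof.
apply: primrec_comp2.
have := @primrec_rec 2 _ (fun _ r a => r * nth 0 a 0) _ (primrec_cst _ 1)
  (primrec_mul (primrec_nth _ 1) (primrec_behead (primrec_behead (primrec_nth 2 0))))
  (primrec_nth _ 1).
case=> P hP; exists P => -[|x [|y []]] // /hP -> /=.
by elim: y => [|y /= ->] //; rewrite expnSr.
Qed.

Lemma primrec_leq n f g : primrec_fun n f -> primrec_fun n g ->
  primrec_fun n (fun a => f a <= g a).
Proof.
move=> Hf Hg; have := primrec_sub (primrec_cst n 1) (primrec_sub Hf Hg).
by apply: primrec_ext => a _; rewrite /leq; case: (f a - g a).
Qed.

Lemma primrec_and n (f g : seq nat -> bool) :
  primrec_fun n (fun a => f a) -> primrec_fun n (fun a => g a) ->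
  primrec_fun n (fun a => f a && g a).
Proof.
move=> Hf Hg; apply: primrec_ext (primrec_mul Hf Hg) => a _.
by rewrite mulnb.
Qed.

Lemma primrec_not n (f : seq nat -> bool) :
  primrec_fun n (fun a => f a) -> primrec_fun n (fun a => ~~ f a).
Proof.
move=> Hf; apply: primrec_ext (primrec_sub (primrec_cst n 1) Hf) => a _.
by case: (f a).
Qed.

Lemma primrec_eq n (f g : seq nat -> nat) : primrec_fun n f -> primrec_fun n g ->
  primrec_fun n (fun a => f a == g a).
Proof.
move=> Hf Hg; have := primrec_and (primrec_leq Hf Hg) (primrec_leq Hg Hf).
by apply: primrec_ext => a _; rewrite eqn_leq.
Qed.

Lemma primrec_if n (b : seq nat -> bool) f g :
  primrec_fun n (fun a => b a) -> primrec_fun n f -> primrec_fun n g ->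
  primrec_fun n (fun a => if b a then f a else g a).
Proof.
move=> Hb Hf Hg.
have := primrec_add (primrec_mul Hb Hf) (primrec_mul (primrec_not Hb) Hg).
by apply: primrec_ext => a _; case: (b a); rewrite ?mul0n ?mul1n ?addn0.
Qed.

(** A recursion step receives counter, accumulator and arguments; a summand depends on the index and
    arguments only, so the accumulator is skipped. *)
Lemma primrec_drop2nd n f : primrec_fun n.+1 f ->
  primrec_fun n.+2 (fun l => f (nth 0 l 0 :: behead (behead l))).
Proof.
move=> [F hF].
exists (PComp F (PProj 0 :: [seq PProj i | i <- iota 2 n])) => -[|x [|y l]] // [sl].
rewrite /= -map_comp.
have -> : [seq ((pr_eval^~ [:: x, y & l]) \o [eta PProj]) i | i <- iota 2 n] = l.
  by rewrite (iotaDl 2 0) -map_comp -[RHS](mkseq_nth 0) sl.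
by rewrite hF /= ?sl.
Qed.

Lemma primrec_sum n c f : primrec_fun n c ->
  primrec_fun n.+1 (fun l => f (nth 0 l 0) (behead l)) ->
  primrec_fun n (fun a => \sum_(i < c a) f i a).
Proof.
move=> Hc HF.
have {}HF := primrec_add (primrec_nth _ 1) (primrec_drop2nd HF).
have := @primrec_rec n _ (fun k r a => r + f k a) c (primrec_cst _ 0) HF Hc.
apply: primrec_ext => a _; elim: (c a) => [|k /= ->]; first by rewrite big_ord0.
by rewrite big_ord_recr.
Qed.

(** Presents [m] as a count below a bound; quotients, logarithms and least witnesses are all
    computed in this way. *)
Lemma sum_ltn n m : m <= n -> \sum_(k < n) (k < m : nat) = m.
Proof.
move=> le_mn; rewrite -(big_mkord xpredT (fun k => (k < m : nat))).
rewrite (big_cat_nat (leq0n m) le_mn) /= (eq_big_nat _ _ (F2 := fun=> 1)).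
  rewrite [X in _ + X](eq_big_nat _ _ (F2 := fun=> 0)) => [|k /andP[mk _]].
    by rewrite !sum_nat_const_nat muln1 muln0 addn0 subn0.
  by rewrite ltnNge mk.
by move=> k /andP[_ ->].
Qed.

Lemma primrec_div n f g : primrec_fun n f -> primrec_fun n g ->
  primrec_fun n (fun a => f a %/ g a).
Proof.
apply: primrec_comp2.
(* The quotient counts the [q] with [(q + 1) * y <= x]; the leading factor enforces [x %/ 0 = 0]. *)
have : primrec_fun 2 (fun a => (0 < nth 0 a 1) *
    \sum_(q < nth 0 a 0) (q.+1 * nth 0 a 1 <= nth 0 a 0)).
  apply: primrec_mul; first exact: primrec_leq (primrec_cst _ _) (primrec_nth _ _).
  apply: (@primrec_sum _ _
    (fun q (a : seq nat) => q.+1 * nth 0 a 1 <= nth 0 a 0)); first exact: primrec_nth.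
  exact: primrec_leq
    (primrec_mul (primrec_S (primrec_nth 3 0)) (primrec_behead (primrec_nth 2 1)))
    (primrec_behead (primrec_nth 2 0)).
apply: primrec_ext => -[|x [|y []]] //= _.
case: y => [|y]; first by rewrite mul0n divn0.
rewrite mul1n (eq_bigr (fun q : 'I_x => (q < x %/ y.+1 : nat))) => [|q _].
  exact/sum_ltn/leq_div.
by rewrite leq_divRL.
Qed.

Lemma primrec_mod n f g : primrec_fun n f -> primrec_fun n g ->
  primrec_fun n (fun a => f a %% g a).
Proof.
move=> Hf Hg; have := primrec_sub Hf (primrec_mul (primrec_div Hf Hg) Hg).
by apply: primrec_ext => a _; rewrite {1}(divn_eq (f a) (g a)) addKn.
Qed.

Definition bit (y r : nat) : bool := odd (y %/ 2 ^ r).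

Lemma primrec_odd n f : primrec_fun n f -> primrec_fun n (fun a => odd (f a)).
Proof.
move=> Hf; apply: primrec_ext (primrec_mod Hf (primrec_cst n 2)) => a _.
by rewrite modn2.
Qed.

Lemma primrec_bit n f g : primrec_fun n f -> primrec_fun n g ->
  primrec_fun n (fun a => bit (f a) (g a)).
Proof.
move=> Hf Hg; apply: primrec_odd; apply: primrec_div => //.
exact: primrec_exp (primrec_cst _ _) Hg.
Qed.

Lemma primrec_clog2 n f : primrec_fun n f -> primrec_fun n (fun a => clog2 (f a)).
Proof.
apply: primrec_comp1.
(* The logarithm of [k] is the number of [e < k] with [2 ^ e < k]. *)
have := @primrec_sum 1 (fun a => nth 0 a 0) (fun e a => 2 ^ e < nth 0 a 0)
  (primrec_nth _ _).
case.
  exact: primrec_leq (primrec_S (primrec_exp (primrec_cst 2 2) (primrec_nth 2 0)))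
    (primrec_behead (primrec_nth 1 0)).
move=> P hP; exists P => -[|k []] // /hP -> /=.
have le_log : clog2 k <= k by rewrite up_log_min // ltnW // ltn_expl.
rewrite -[RHS](sum_ltn le_log); apply: eq_bigr => e _; congr (nat_of_bool _).
rewrite !ltnNge; congr (~~ _); apply/idP/idP => [|le_e]; first exact: up_log_min.
exact: leq_trans (up_logP _ _) (leq_pexp2l _ le_e).
Qed.

(* The least [k < B] satisfying [P], and [B] if there is none. *)
Definition bmin (P : pred nat) (B : nat) : nat :=
  \sum_(k < B) (\sum_(l < k.+1) P l == 0).

(** [bmin] counts the [k] with no witness at or below [k]; these are the numbers below the least
    witness. *)
Lemma bminP (P : pred nat) B k : k < B -> P k -> P (bmin P B) /\ bmin P B < B.
Proof.
move=> kB Pk; have exP : exists k, P k by exists k.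
have [m Pm minm] := ex_minnP exP.
have mB : m < B := leq_ltn_trans (minm _ Pk) kB.
suff -> : bmin P B = m by [].
rewrite -[RHS](sum_ltn (ltnW mB)); apply: eq_bigr => j _.
congr (nat_of_bool _); rewrite sum_nat_eq0; apply/forallP/idP => [H|ltjm l].
  rewrite ltnNge; apply/negP => le_mj.
  by have /eqP := H (Ordinal (leq_ltn_trans le_mj (ltnSn _))); rewrite /= Pm.
apply/implyP => _; rewrite eqb0; apply/negP => /minm.
by rewrite leqNgt (leq_ltn_trans (leq_ord l) ltjm).
Qed.

Lemma primrec_bmin n (P : nat -> seq nat -> bool) B : primrec_fun n B ->
  primrec_fun n.+1 (fun l => P (nth 0 l 0) (behead l)) ->
  primrec_fun n (fun a => bmin (P^~ a) (B a)).
Proof.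
move=> HB HP.
apply: (@primrec_sum n B (fun k a => \sum_(l < k.+1) P l a == 0)) => //.
apply: primrec_eq (primrec_cst _ _).
apply: (@primrec_sum n.+1 (fun l => (nth 0 l 0).+1) (fun x l => P x (behead l))).
  exact/primrec_S/primrec_nth.
exact: primrec_drop2nd HP.
Qed.

(** * A binary code of rate 1/6 and relative distance above 1/6 *)

Lemma bit0 y : bit y 0 = odd y.
Proof. by rewrite /bit expn0 divn1. Qed.

Lemma bitS y r : bit y r.+1 = bit y./2 r.
Proof. by rewrite /bit expnS divnMA divn2. Qed.

Lemma sum_pow2_recl K (f : nat -> bool) :
  \sum_(l < K.+1) f l * 2 ^ l = f 0 + (\sum_(l < K) f l.+1 * 2 ^ l).*2.
Proof.
rewrite big_ord_recl /= expn0 muln1; congr (_ + _).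
rewrite -mul2n big_distrr /=; apply: eq_bigr => l _.
by rewrite mulnCA -expnS.
Qed.

Lemma bit_sum K (f : nat -> bool) k : k < K ->
  bit (\sum_(l < K) f l * 2 ^ l) k = f k.
Proof.
elim: K f k => // K IH f [|k] ltk; rewrite sum_pow2_recl.
  by rewrite bit0 oddD odd_double addbF; case: (f 0).
by rewrite bitS half_bit_double (IH (fun l => f l.+1)).
Qed.

Lemma sum_bits K y : y < 2 ^ K -> \sum_(l < K) bit y l * 2 ^ l = y.
Proof.
elim: K y => [|K IH] y lty; first by rewrite big_ord0; case: y lty.
rewrite sum_pow2_recl bit0 (eq_bigr (fun l : 'I_K => bit y./2 l * 2 ^ l)).
  rewrite IH ?odd_double_half //.
  by rewrite -ltn_double -[X in _ < X]mul2n -expnS (leq_ltn_trans _ lty) //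
    -[X in _ <= X]odd_double_half leq_addl.
by move=> l _; rewrite bitS.
Qed.

Lemma sum_pow2_lt K (f : nat -> bool) : \sum_(l < K) f l * 2 ^ l < 2 ^ K.
Proof.
elim: K f => [|K IH] f; first by rewrite big_ord0.
have := IH (fun l => f l.+1); rewrite sum_pow2_recl expnS mul2n -ltn_Sdouble.
by apply: leq_ltn_trans; case: (f 0).
Qed.

Lemma prod_if_exp (I : finType) (P : pred I) c d :
  \prod_i (if P i then c else d) = c ^ #|P| * d ^ (#|I| - #|P|).
Proof.
rewrite (bigID P) /= (eq_bigr (fun=> c)) => [|i ->] //.
rewrite [X in _ * X](eq_bigr (fun=> d)) => [|i /negbTE ->] //.
rewrite !prod_nat_const; congr (_ ^ #|_| * _ ^ _).
  by rewrite -(cardC P) addKn.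
Qed.

Section CodeExistence.

Variable L : nat.
Let word := {ffun 'I_L -> bool}.

(** Flipping a coordinate in the support of [u] pairs columns of opposite parity, and each pair
    contributes 1 + 2. *)
Lemma sum_parity_weight (u : word) : u != [ffun=> false] ->
  2 * (\sum_(c : word) if odd (\sum_r (u r && c r)) then 1 else 2) = 3 * 2 ^ L.
Proof.
move=> nz.
have [r0 ur0] : exists r, u r.
  apply/existsP; apply: contraT; rewrite negb_exists => /forallP H.
  by case/eqP: nz; apply/ffunP => r; rewrite ffunE; apply/negbTE/H.
pose flip (c : word) : word := [ffun r => c r (+) (r == r0)].
have flipK : involutive flip.
  by move=> c; apply/ffunP=> r; rewrite !ffunE addbK.
have oddflip c : odd (\sum_r (u r && flip c r)) = ~~ odd (\sum_r (u r && c r)).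
  rewrite (bigD1 r0) // [in RHS](bigD1 r0) //= !oddD ffunE eqxx ur0 addbT !oddb addNb.
  congr (~~ (_ (+) odd _)).
  by apply: eq_bigr => r /negbTE nr; rewrite ffunE nr addbF.
rewrite mul2n -addnn {2}(reindex_inj (inv_inj flipK)) -big_split /=.
rewrite (eq_bigr (fun=> 3)) => [|c _]; last by rewrite oddflip; case: odd.
by rewrite sum_nat_const card_ffun card_bool card_ord mulnC.
Qed.

(* First moment of the weight enumerator at 1/2, over a uniformly random
   matrix given by its [6 * L] columns. *)
Lemma good_columns_exist : 0 < L ->
  exists A : {ffun 'I_(6 * L) -> word}, forall u : word, u != [ffun=> false] ->
    L < \sum_j odd (\sum_r (u r && A j r)).
Proof.
move=> L_gt0; pose good (A : {ffun 'I_(6 * L) -> word}) :=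
  [forall u : word, (u != [ffun=> false]) ==>
  (L < \sum_(j < 6 * L) odd (\sum_r (u r && A j r)))].
suff [A gA] : exists A : {ffun 'I_(6 * L) -> word}, good A.
  by exists A => u nu; move/forallP/(_ u)/implyP: gA; apply.
apply/existsP; apply: contraT; rewrite negb_exists => /forallP allbad.
(* [W u A] is 2 to the number of zeros in the codeword of [u]: the enumerator at 1/2, rescaled to
   stay integral. *)
pose W (u : word) (A : {ffun 'I_(6 * L) -> word}) :=
  \prod_j if odd (\sum_r (u r && A j r)) then 1 else 2.
(* If every [A] is bad, some nonzero message has a codeword with at most [L] ones, hence at least
   [5 * L] zeros. *)
have low : 2 ^ (L * (6 * L)) * 2 ^ (5 * L) <=
    \sum_A \sum_(u : word | u != [ffun=> false]) W u A.
  have -> : 2 ^ (L * (6 * L)) = #|{: {ffun 'I_(6 * L) -> word}}|.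
    by rewrite !card_ffun card_bool !card_ord expnM.
  rewrite -sum_nat_const; apply: leq_sum => A _.
  have := allbad A; rewrite negb_forall => /existsP[u].
  rewrite negb_imply -leqNgt => /andP[nu le_wt].
  rewrite (bigD1 u nu) /=; apply: leq_trans (leq_addr _ _).
  rewrite /W prod_if_exp exp1n mul1n leq_exp2l // card_ord.
  set P := (X in #|X|).
  have wtE : \sum_(j < 6 * L) odd (\sum_r (u r && A j r)) = #|P|.
    by rewrite -sum1_card [RHS]big_mkcond; apply: eq_bigr => j _; rewrite unfold_in /P; case: odd.
  rewrite leq_subRL; last by rewrite -[X in _ <= X]card_ord max_card.
  by rewrite [X in _ <= X](mulSn 5) leq_add2r -wtE.
(* The columns are independent, so the sum over [A] is a product over columns; the factor
   [2 ^ (6 * L)] clears the denominator of [(3 * 2 ^ L / 2) ^ (6 * L)]. *)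
have up : 2 ^ (6 * L) * (\sum_A \sum_(u : word | u != [ffun=> false]) W u A) <=
    2 ^ L * (3 * 2 ^ L) ^ (6 * L).
  rewrite exchange_big big_distrr /=.
  have -> : 2 ^ L = #|{: word}| by rewrite card_ffun card_bool card_ord.
  rewrite -sum_nat_const big_mkcond; apply: leq_sum => u _.
  case: ifP => // nu; rewrite /W.
  have <- := bigA_distr_bigA (fun (j : 'I_(6 * L)) (c : word) =>
    if odd (\sum_r (u r && c r)) then 1 else 2).
  rewrite prod_nat_const card_ord -expnMn sum_parity_weight //.
  by rewrite card_ffun card_bool card_ord.
(* After cancellation the two bounds would give [(2 ^ 11) ^ L <= (2 * 3 ^ 6) ^ L], but 2048 exceeds
   1458. *)
have := leq_trans (leq_mul (leqnn (2 ^ (6 * L))) low) up.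
rewrite expnMn -expnM [X in _ <= _ * X]mulnC !mulnA [X in X * _ <= _]mulnC.
rewrite -!mulnA [X in _ <= X]mulnC -!mulnA leq_pmul2l ?expn_gt0 //.
rewrite !expnM -!expnMn leqNgt ltn_exp2r //.
Qed.

End CodeExistence.

(** * Numerical encoding of the code, its syndromes and the labels *)

Definition parity_of (L a u j : nat) : bool :=
  odd (\sum_(r < L) (bit u r && bit a (j * L + r))).

(* Bit [j * L + r] of [a] is the entry in row [r] and column [j] of a generator
   matrix; the code it generates has minimum distance greater than [L]. *)
Definition good_code (L a : nat) : bool :=
  \sum_(u < 2 ^ L) ((0 < u) && (\sum_(j < 6 * L) parity_of L a u j <= L)) == 0.

Definition code (L : nat) : nat := bmin (good_code L) (2 ^ (6 * L * L)).

(** The generator matrix acts here as a parity-check matrix. Its nonzero row combinations have more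
    than [L] ones, so prescribing any [L] bits of a uniform word leaves the syndrome uniform. *)
Definition syndrome (L y r : nat) : bool :=
  odd (\sum_(j < 6 * L) (bit (code L) (j * L + r) && bit y j)).

Definition synd_num (L y : nat) : nat := \sum_(r < L) syndrome L y r * 2 ^ r.

(* Label [t.+1] stands for the unit vector of coordinate [t], label 0 for the
   zero vector. *)
Definition label (n y : nat) : nat :=
  let s := synd_num (clog2 n.+1) y in if s <= n then s else 0.

Lemma index_lt m n (i : 'I_m) (j : 'I_n) : i * n + j < m * n.
Proof.
apply: leq_trans (_ : i.+1 * n <= _); first by rewrite mulSn addnC ltn_add2r.
by rewrite leq_mul2r ltn_ord orbT.
Qed.

Lemma good_code_exists L : 0 < L -> exists2 a, a < 2 ^ (6 * L * L) & good_code L a.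
Proof.
move=> L_gt0; have [A hA] := good_columns_exist L_gt0.
pose f k : bool := if insub (k %/ L) is Some j then
  (if insub (k %% L) is Some r then A j r else false) else false.
have fE (j : 'I_(6 * L)) (r : 'I_L) : f (j * L + r) = A j r.
  by rewrite /f divnMDl // modnMDl divn_small // modn_small // addn0 !valK.
exists (\sum_(l < 6 * L * L) f l * 2 ^ l); first exact: sum_pow2_lt.
rewrite /good_code sum_nat_eq0; apply/forallP => u; apply/implyP => _.
rewrite eqb0 negb_and -implybE -ltnNge; apply/implyP => u_gt0.
pose v : {ffun 'I_L -> bool} := [ffun r : 'I_L => bit u r].
have -> : \sum_(j < 6 * L) parity_of L (\sum_(l < 6 * L * L) f l * 2 ^ l) u j =
    \sum_(j < 6 * L) odd (\sum_(r < L) (v r && A j r)).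
  apply: eq_bigr => j _; congr (nat_of_bool (odd _)); apply: eq_bigr => r _.
  by rewrite bit_sum ?index_lt // fE ffunE.
apply: hA; apply: contraTneq u_gt0 => /ffunP v0.
rewrite -(sum_bits (ltn_ord u)) big1 // => r _.
by have := v0 r; rewrite !ffunE => ->.
Qed.

Lemma codeP L (u : {ffun 'I_L -> bool}) : u != [ffun=> false] ->
  L < \sum_(j < 6 * L) odd (\sum_(r < L) (u r && bit (code L) (j * L + r))).
Proof.
move=> nz; have L_gt0 : 0 < L.
  case: L u nz => // u /eqP[]; apply/ffunP => -[] //.
have [a lta ga] := good_code_exists L_gt0.
have [+ _] := bminP lta ga; rewrite -/(code L) /good_code sum_nat_eq0.
pose f k : bool := if insub k is Some r then u r else false.
have ltU := sum_pow2_lt L f.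
move=> /forallP/(_ (Ordinal ltU)); rewrite /= eqb0 negb_and -implybE -ltnNge.
have bitU (r : 'I_L) : bit (\sum_(l < L) f l * 2 ^ l) r = u r.
  by rewrite bit_sum // /f valK.
move=> /implyP H; apply: leq_trans (H _) _.
  rewrite lt0n; apply: contra nz => /eqP U0; apply/eqP/ffunP => r.
  by rewrite -bitU U0 ffunE /bit div0n.
apply: eq_leq; apply: eq_bigr => j _; congr (nat_of_bool (odd _)).
by apply: eq_bigr => r _; rewrite bitU.
Qed.

Lemma eq_label n y y' : (forall j, j < 6 * clog2 n.+1 -> bit y j = bit y' j) ->
  label n y = label n y'.
Proof.
move=> eqb; rewrite /label; suff -> : synd_num (clog2 n.+1) y =
  synd_num (clog2 n.+1) y' by [].
apply: eq_bigr => r _; congr (nat_of_bool (odd _) * _).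
by apply: eq_bigr => j _; rewrite eqb.
Qed.

Lemma label_le n y : label n y <= n.
Proof. by rewrite /label; case: ifP. Qed.

Definition word_bit (m : nat) (y : cube m) (l : nat) : bool :=
  if insub l is Some j then y j else false.

Definition num_of_word (m : nat) (y : cube m) : nat :=
  \sum_(l < m) word_bit y l * 2 ^ l.

Lemma bit_num_of_word m (y : cube m) (j : 'I_m) : bit (num_of_word y) j = y j.
Proof. by rewrite /num_of_word bit_sum // /word_bit valK. Qed.

(** * Low-degree moments on the fibers of the syndrome *)

Section Moments.

Variable R : realType.
Local Open Scope ring_scope.

Lemma prod_sign_sum (I : finType) (F : I -> nat) :
  \prod_i (-1) ^+ F i = (-1) ^+ (\sum_i F i)%N :> R.
Proof. by rewrite (big_morph (fun k => (-1) ^+ k) (exprD (-1 : R)) (expr0 _)). Qed.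

(** The sum factors over the coordinates, and the factor at [j] is [1 + (-1) = 0]. *)
Lemma sum_sign_prod m (S : {set 'I_m}) (c : 'I_m -> bool) (j : 'I_m) :
  j \notin S -> c j ->
  \sum_(y : cube m) (\prod_(i in S) (y i)%:R) * \prod_i (-1) ^+ (c i && y i)%N = 0 :> R.
Proof.
move=> jS cj.
under eq_bigr => y _ do rewrite big_mkcond -big_split /=.
have <- := bigA_distr_bigA (fun i (b : bool) =>
  (if i \in S then b%:R else 1) * (-1) ^+ (c i && b)%N : R).
rewrite (bigD1 j) //= big_bool /= (negbTE jS) cj /=.
by rewrite expr1 expr0 !mul1r addNr mul0r.
Qed.

(* Fourier expansion of the indicator of [synd = s] over the row combinations [u];
   only the term [u = 0] survives against a monomial of degree at most [L]. *)
Lemma syndrome_fiber_moment L (S : {set 'I_(6 * L)}) (s : 'I_L -> bool) :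
  (#|S| <= L)%N ->
  2 ^+ L * (\sum_(y : cube (6 * L) |
       [forall r : 'I_L, syndrome L (num_of_word y) r == s r])
     \prod_(j in S) (y j)%:R) =
  \sum_(y : cube (6 * L)) \prod_(j in S) (y j)%:R :> R.
Proof.
move=> leS; pose H (j : 'I_(6 * L)) (r : 'I_L) := bit (code L) (j * L + r).
have synE y (r : 'I_L) :
    syndrome L (num_of_word y) r = odd (\sum_(j < 6 * L) (H j r && y j)).
  by congr odd; apply: eq_bigr => j _; rewrite bit_num_of_word.
(* [2 ^ L] times the indicator is the product over [r] of [1 + (-1) ^ (a_r + s_r)], with [a_r] the
   syndrome bits; expanding it yields the sum over [u]. *)
have ind y : 2 ^+ L * ([forall r : 'I_L, syndrome L (num_of_word y) r == s r])%:R =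
    \sum_(u : {ffun 'I_L -> bool})
      (\prod_r (-1) ^+ (u r && s r)%N) *
      \prod_j (-1) ^+ (odd (\sum_r (u r && H j r)) && y j)%N :> R.
  transitivity (\prod_(r < L)
     \sum_(b : bool) (-1) ^+ (b && (syndrome L (num_of_word y) r (+) s r))%N : R).
    case: (boolP [forall r, _]) => [/forallP eqs|/forallPn[r nr]].
      rewrite mulr1 (eq_bigr (fun=> 2)) => [|r _].
        by rewrite prodr_const card_ord.
      by rewrite (eqP (eqs r)) addbb big_bool /= expr0.
    rewrite mulr0 (bigD1 r) //= big_bool /=.
    by case: (syndrome _ _ _) nr; case: (s r) => //= _; rewrite addNr mul0r.
  rewrite bigA_distr_bigA; apply: eq_bigr => u _.
  have -> : \prod_r (-1) ^+ (u r && (syndrome L (num_of_word y) r (+) s r))%N =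
    (\prod_r (-1) ^+ (u r && s r)%N) *
    \prod_r (-1) ^+ (u r * \sum_(j < 6 * L) (H j r && y j))%N :> R.
    rewrite -big_split; apply: eq_bigr => r _ /=; rewrite synE.
    case: (u r) => /=; last by rewrite mul0n !expr0 mulr1.
    by rewrite mul1n signr_addb signr_odd mulrC.
  congr (_ * _).
  have -> : \prod_j (-1) ^+ (odd (\sum_r (u r && H j r)) && y j)%N =
     \prod_j (-1) ^+ ((\sum_r (u r && H j r)) * y j)%N :> R.
    apply: eq_bigr => j _; case: (y j); last by rewrite andbF muln0.
    by rewrite andbT muln1 signr_odd.
  rewrite !prod_sign_sum; congr (_ ^+ _).
  under eq_bigr => r _ do rewrite big_distrr /=.
  rewrite exchange_big; apply: eq_bigr => j _; rewrite big_distrl /=.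
  by apply: eq_bigr => r _; rewrite -!mulnb mulnA.
rewrite big_mkcond big_distrr /=.
transitivity (\sum_(y : cube (6 * L)) \sum_(u : {ffun 'I_L -> bool})
   (\prod_r (-1) ^+ (u r && s r)%N) * ((\prod_(j in S) (y j)%:R) *
      \prod_j (-1) ^+ (odd (\sum_r (u r && H j r)) && y j)%N) : R).
  apply: eq_bigr => y _.
  have := ind y; set A := [forall _, _]; move=> indy.
  have -> : (if A then \prod_(j in S) (y j)%:R else 0) =
    A%:R * \prod_(j in S) (y j)%:R :> R by case: A {indy}; rewrite ?mul1r ?mul0r.
  rewrite mulrA indy big_distrl; apply: eq_bigr => u _ /=.
  by rewrite -mulrA [X in _ * X]mulrC.
rewrite exchange_big (bigD1 [ffun=> false]) //= [X in _ + X]big1 ?addr0; last first.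
  move=> u nz; rewrite -big_distrr /=.
  (* The codeword of [u] has more than [L] ones, while [S] has at most [L] elements. *)
  have [j jS cj] : exists2 j, j \notin S & odd (\sum_r (u r && H j r)).
    apply/exists_inP; apply: contraT; rewrite negb_exists_in => /forall_inP all0.
    have := codeP nz; rewrite ltnNge => /negP[]; apply: leq_trans leS.
    rewrite -sum1_card [X in (_ <= X)%N]big_mkcond; apply: leq_sum => j _.
    case: ifPn => [_|/all0 /negbTE ->] //; exact: leq_b1.
  by rewrite (sum_sign_prod jS cj) mulr0.
apply: eq_bigr => y _; rewrite [X in X * _]big1 => [|r _]; last by rewrite ffunE.
rewrite mul1r [X in _ * X]big1 ?mulr1 // => j _.
by rewrite big1 // => r _; rewrite ffunE.
Qed.

End Moments.

Section LabelMoments.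

Variables (R : realType) (n : nat).
Local Notation L := (clog2 n.+1).

Definition word_label (y : cube (6 * clog2 n.+1)) : nat := label n (num_of_word y).

(** With [S] empty, the moment identity shows that no syndrome fiber is empty, and every
    [t <= n < 2 ^ L] is the number of some syndrome. *)
Lemma word_label_surj t : t <= n -> exists y, word_label y = t.
Proof.
move=> le_tn; have := @syndrome_fiber_moment R L set0 (bit t).
rewrite cards0 => /(_ isT).
have [y /forallP syn_y _|none] := pickP (fun y : cube (6 * L) =>
    [forall r : 'I_L, syndrome L (num_of_word y) r == bit t r]); last first.
  rewrite big_pred0 // mulr0 => /eqP.
  under [in X in _ == X -> _]eq_bigr => y _ do rewrite big_set0.
  by rewrite sumr_const eq_sym pnatr_eq0 card_ffun card_bool card_ord expn_eq0.
exists y; rewrite /word_label /label.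
have -> : synd_num L (num_of_word y) = t.
  rewrite -[RHS](@sum_bits L); last exact: (@leq_trans n.+1 t.+1 _ le_tn (up_logP _ _)).
  by apply: eq_bigr => r _; rewrite (eqP (syn_y r)).
by rewrite le_tn.
Qed.

(** A label fiber is a union of syndrome fibers, all of which give the monomial the same sum. So [c]
    is its mean over all words. *)
Lemma label_fiber_moment (S : {set 'I_(6 * L)}) : #|S| <= L ->
  exists c : R, forall t, (\sum_(y | word_label y == t) \prod_(j in S) (y j)%:R =
    c * #|[pred y | word_label y == t]|%:R)%R.
Proof.
move=> leS; pose tot (U : {set 'I_(6 * L)}) : R :=
  (\sum_(y : cube (6 * L)) \prod_(j in U) (y j)%:R)%R.
have tot0 : (tot set0 != 0)%R.
  rewrite /tot; under eq_bigr => y _ do rewrite big_set0.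
  by rewrite sumr_const pnatr_eq0 card_ffun card_bool card_ord expn_eq0.
pose syn (y : cube (6 * L)) : {ffun 'I_L -> bool} :=
  [ffun r : 'I_L => syndrome L (num_of_word y) r].
pose lab (s : {ffun 'I_L -> bool}) :=
  let k := \sum_(r < L) s r * 2 ^ r in if k <= n then k else 0.
have labE y : word_label y = lab (syn y).
  rewrite /word_label /label /lab /synd_num.
  have -> : \sum_(r < L) syn y r * 2 ^ r =
    \sum_(r < L) syndrome L (num_of_word y) r * 2 ^ r; last by [].
  by apply: eq_bigr => r _; rewrite ffunE.
have fib (U : {set 'I_(6 * L)}) t : #|U| <= L ->
    (\sum_(y | word_label y == t) \prod_(j in U) (y j)%:R =
     (2 ^- L * tot U) *+ #|[pred s | lab s == t]|)%R.
  move=> leU; rewrite (partition_big syn (fun s => lab s == t)) => [|y]; last first.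
    by rewrite labE.
  rewrite -sumr_const; apply: eq_bigr => s /eqP labs.
  apply: (mulfI (_ : 2 ^+ L != 0)%R); first by rewrite expf_neq0 ?pnatr_eq0.
  rewrite mulVKf ?expf_neq0 ?pnatr_eq0 // /tot -(@syndrome_fiber_moment R L U s leU).
  congr (_ * _)%R; apply: eq_bigl => y; rewrite labE.
  apply/andP/forallP => [[_ /eqP<-] r|eqs]; first by rewrite ffunE.
  have E : syn y = s by apply/ffunP => r; rewrite ffunE; apply/eqP.
  by rewrite E labs !eqxx.
exists (tot S / tot set0)%R => t.
(* The empty monomial counts the fiber. *)
have := fib set0 t; rewrite cards0 => /(_ isT).
under eq_bigr => y _ do rewrite big_set0.
rewrite sumr_const (fib S t leS) => ->.
rewrite mulrnAr; congr (_ *+ _)%R.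
by rewrite [RHS]mulrCA divfK.
Qed.

End LabelMoments.

(** * Explicit formulas *)

Ltac primrec_auto := repeat first
  [ assumption
  | match goal with H : primrec_fun _ _ |- _ => exact (primrec_behead H) end
  | exact: primrec_cst | exact: primrec_nth | apply: primrec_leq
  | apply: primrec_eq | apply: primrec_bit | apply: primrec_and
  | apply: primrec_exp | apply: primrec_mod | apply: primrec_div
  | apply: primrec_clog2 | apply: primrec_mul | apply: primrec_add
  | apply: primrec_if | apply: primrec_S ].

Lemma primrec_parity n L a u j : primrec_fun n L -> primrec_fun n a ->
  primrec_fun n u -> primrec_fun n j ->
  primrec_fun n (fun x => parity_of (L x) (a x) (u x) (j x)).
Proof.
move=> HL Ha Hu Hj; apply: primrec_odd.
apply: (@primrec_sum n _ (fun r x => bit (u x) r && bit (a x) (j x * L x + r))) => //.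
by primrec_auto.
Qed.

Lemma primrec_good_code n L a : primrec_fun n L -> primrec_fun n a ->
  primrec_fun n (fun x => good_code (L x) (a x)).
Proof.
move=> HL Ha; apply: primrec_eq (primrec_cst _ _).
apply: (@primrec_sum n _ (fun u x =>
  (0 < u) && (\sum_(j < 6 * L x) parity_of (L x) (a x) u j <= L x))).
  by primrec_auto.
apply: primrec_and; first by primrec_auto.
apply: primrec_leq; last by primrec_auto.
apply: (@primrec_sum n.+1 _ (fun j x =>
  parity_of (L (behead x)) (a (behead x)) (nth 0 x 0) j)); first by primrec_auto.
apply: primrec_parity; try exact: primrec_nth;
  try exact: primrec_behead (primrec_nth _ _);
  exact: primrec_behead (primrec_behead _).
Qed.

Lemma primrec_code n L : primrec_fun n L -> primrec_fun n (fun x => code (L x)).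
Proof.
move=> HL; apply: (@primrec_bmin n (fun a x => good_code (L x) a)).
  by primrec_auto.
by apply: primrec_good_code; primrec_auto.
Qed.

Lemma primrec_label n f y : primrec_fun n f -> primrec_fun n y ->
  primrec_fun n (fun x => label (f x) (y x)).
Proof.
move=> Hf Hy.
have HL : primrec_fun n (fun x => clog2 (f x).+1) by primrec_auto.
suff Hs : primrec_fun n (fun x => synd_num (clog2 (f x).+1) (y x)).
  apply: (@primrec_if n
    (fun x => synd_num (clog2 (f x).+1) (y x) <= f x)) => //; by primrec_auto.
apply: (@primrec_sum n _ (fun r x => syndrome (clog2 (f x).+1) (y x) r * 2 ^ r)) => //.
apply: primrec_mul; last by primrec_auto.
apply: primrec_odd; apply: (@primrec_sum n.+1 _ (fun j x =>
  bit (code (clog2 (f (behead x)).+1)) (j * clog2 (f (behead x)).+1 + nth 0 x 0)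
  && bit (y (behead x)) j)); first by primrec_auto.
(* The programs are weakened twice, past the column and row indices. *)
have HL2 := primrec_behead (primrec_behead HL).
have Hc2 := primrec_code HL2.
have Hy2 := primrec_behead (primrec_behead Hy).
have H0 := primrec_behead (primrec_nth n.+1 0).
by primrec_auto.
Qed.

(* A word with the wrong label is replaced by a fixed one with the right label, so
   that every index yields a legitimate term. *)
Definition term_word (n i y : nat) : nat :=
  if label n y == i.+1 then y
  else bmin (fun y' => label n y' == i.+1) (2 ^ (6 * clog2 n.+1)).

Lemma primrec_term_word n f i y : primrec_fun n f -> primrec_fun n i ->
  primrec_fun n y -> primrec_fun n (fun x => term_word (f x) (i x) (y x)).
Proof.
move=> Hf Hi Hy; apply: primrec_if => //.
  by apply: primrec_eq; [exact: primrec_label | primrec_auto].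
apply: (@primrec_bmin n (fun y' x => label (f x) y' == (i x).+1)).
  by primrec_auto.
by apply: primrec_eq; [apply: primrec_label|]; primrec_auto.
Qed.

(** Since the labels are surjective, the search for a replacement word succeeds below its bound. *)
Lemma label_term_word (R : realType) n i y : i < n -> label n (term_word n i y) = i.+1.
Proof.
move=> lt_in; rewrite /term_word; case: ifP => [/eqP //|_].
have [w hw] := word_label_surj R lt_in.
have [/eqP //] := @bminP (fun y' => label n y' == i.+1) _ (num_of_word w)
  (sum_pow2_lt _ _) (introT eqP hw).
Qed.

(* With [m] the block length, term [k] fixes block [k %/ 2 ^ m] to the word coded
   by [term_word n i (k %% 2 ^ m)]. *)
Definition literal_code (n i k j : nat) : nat :=
  let m := 6 * clog2 n.+1 in
  if j %/ m == k %/ 2 ^ m then (bit (term_word n i (k %% 2 ^ m)) (j %% m)).+1 else 0.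

Definition block_dnf (n theta : nat) (i : 'I_n) : dnf (inputlen n theta) :=
  mkseq (fun k => [ffun j : 'I_(inputlen n theta) =>
           literal_of_code (literal_code n i k j)])
        (theta * 2 ^ (6 * clog2 n.+1)).

Lemma block_dnf_explicit : explicitly_given block_dnf.
Proof.
have [P hP] : primrec_fun 3 (fun a => nth 0 a 1 * 2 ^ (6 * clog2 (nth 0 a 0).+1)).
  by primrec_auto.
have [Q hQ] : primrec_fun 5 (fun a =>
    literal_code (nth 0 a 0) (nth 0 a 2) (nth 0 a 3) (nth 0 a 4)).
  apply: primrec_if; [by primrec_auto| |exact: primrec_cst].
  apply/primrec_S/primrec_bit; last by primrec_auto.
  by apply: primrec_term_word; primrec_auto.
exists P, Q => n theta i; rewrite hP // /block_dnf; apply: eq_mkseq => k.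
by apply/ffunP => j; rewrite !ffunE hQ.
Qed.

(** * Fibers of a sum of independent labels *)

Section FiberMoments.

Variables (R : realType) (n theta : nat) (T : finType) (h : T -> nat).
Hypothesis h_le : forall y, h y <= n.

Implicit Types (x : {ffun 'I_theta -> T}) (v : {ffun 'I_n -> nat}).

(** The sum of the vectors that the labels stand for; label 0 contributes nothing. *)
Definition count_vec x : {ffun 'I_n -> nat} :=
  [ffun i : 'I_n => \sum_b (h (x b) == i.+1)].

Local Open Scope ring_scope.

Definition fiber_sum (F : {ffun 'I_theta -> T} -> R) v : R :=
  \sum_(x | count_vec x == v) F x.

(* [f] is the unnormalized version of a mean over fibers that is a polynomial of
   degree at most [d]; this also makes sense on empty fibers. *)
Definition fiber_poly (d : nat) (f : {ffun 'I_n -> nat} -> R) : Prop :=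
  exists q : {mpoly R[n]}, (msize q <= d.+1)%N /\
    forall v, f v = nat_eval q v * fiber_sum (fun=> 1) v.

Lemma fiber_poly_ext d f f' : f =1 f' -> fiber_poly d f -> fiber_poly d f'.
Proof. by move=> ff' [q [sq qE]]; exists q; split=> // v; rewrite -ff'. Qed.

Lemma fiber_polyW d d' f : (d <= d')%N -> fiber_poly d f -> fiber_poly d' f.
Proof.
by move=> le_d [q [sq qE]]; exists q; split=> //; apply: leq_trans sq _; rewrite ltnS.
Qed.

Lemma fiber_polyZ d c f : fiber_poly d f -> fiber_poly d (fun v => c * f v).
Proof.
move=> [q [sq qE]]; exists (c *: q); split; first exact: leq_trans (msizeZ_le _ _) sq.
by move=> v; rewrite qE /nat_eval mevalZ mulrA.
Qed.

Lemma fiber_polyD d f f' : fiber_poly d f -> fiber_poly d f' ->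
  fiber_poly d (fun v => f v + f' v).
Proof.
move=> [q [sq qE]] [q' [sq' qE']]; exists (q + q'); split.
  by apply: leq_trans (msizeD_le _ _) _; rewrite geq_max sq.
by move=> v; rewrite qE qE' /nat_eval mevalD mulrDl.
Qed.

Lemma fiber_poly_sum d (I : eqType) (r : seq I) (P : pred I) f :
  (forall i, i \in r -> P i -> fiber_poly d (f i)) ->
  fiber_poly d (fun v => \sum_(i <- r | P i) f i v).
Proof.
elim: r => [_|i r IH fP].
  exists 0; rewrite msize0; split=> // v.
  by rewrite big_nil /nat_eval meval0 mul0r.
have {}IH := IH (fun j jr => fP j (mem_behead (s := i :: r) jr)).
case Pi: (P i); last first.
  by apply: fiber_poly_ext IH => v; rewrite big_cons Pi.
by apply: fiber_poly_ext (fiber_polyD (fP i (mem_head _ _) Pi) IH) => v;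
   rewrite big_cons Pi.
Qed.

Lemma fiber_poly_lin d f c0 (c : 'I_n -> R) : fiber_poly d f ->
  fiber_poly d.+1 (fun v => (c0 + \sum_i c i * (v i)%:R) * f v).
Proof.
move=> [q [sq qE]]; pose l : {mpoly R[n]} := c0%:MP + \sum_i c i *: 'X_i.
have sl : (msize l <= 2)%N.
  apply: leq_trans (msizeD_le _ _) _; rewrite geq_max msizeC (leq_trans (leq_b1 _)) //=.
  apply: leq_trans (msize_sum _ _ _) _; apply/bigmax_leqP => i _.
  by apply: leq_trans (msizeZ_le _ _) _; rewrite msizeX mdeg1.
exists (l * q); split.
  have [->|nl] := eqVneq l 0; first by rewrite mul0r msize0.
  have [->|nq] := eqVneq q 0; first by rewrite mulr0 msize0.
  by rewrite msizeM //; have := leq_add sl sq; case: (msize l + msize q)%N.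
move=> v; rewrite qE /nat_eval mevalM mulrA; congr (_ * _ * _).
rewrite mevalD mevalC raddf_sum /=; congr (_ + _).
by apply: eq_bigr => i _; rewrite mevalZ mevalXU.
Qed.

(** Writing [g] as [g 0] plus an increment on the indicator of each nonzero label makes the sum
    affine in the count vector. *)
Lemma sum_labels (g : nat -> R) x :
  \sum_b g (h (x b)) =
  g 0%N * theta%:R + \sum_(i < n) (g i.+1 - g 0%N) * (count_vec x i)%:R.
Proof.
have gE b : g (h (x b)) =
    g 0%N + \sum_(i < n) (g i.+1 - g 0%N) * (h (x b) == i.+1)%:R.
  case E: (h (x b)) => [|t].
    by rewrite big1 ?addr0 // => i _; rewrite mulr0.
  have ltt : (t < n)%N by rewrite -E.
  rewrite (bigD1 (Ordinal ltt)) //= eqxx mulr1 big1 ?addr0 ?subrKC // => i nei.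
  by rewrite eqSS eq_sym (negbTE (nei : val i != t)) mulr0.
under eq_bigr => b _ do rewrite gE.
rewrite big_split /= sumr_const card_ord mulr_natr; congr (_ + _).
rewrite exchange_big; apply: eq_bigr => i _; rewrite -big_distrr /= ffunE.
by rewrite natr_sum.
Qed.

Lemma count_vec_perm x (s : {perm 'I_theta}) :
  count_vec [ffun b => x (s b)] = count_vec x.
Proof.
apply/ffunP => i; rewrite !ffunE [RHS](reindex_inj (@perm_inj _ s)).
by apply: eq_bigr => b _; rewrite ffunE.
Qed.

(* Symmetry makes the position of the last factor irrelevant outside [B]; summing
   over all positions turns it into an affine function of [v], and the positions
   inside [B] give shorter products. *)
Lemma fiber_poly_prod_label (B : {set 'I_theta}) (g : 'I_theta -> nat -> R) :
  fiber_poly #|B| (fiber_sum (fun x => \prod_(b in B) g b (h (x b)))).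
Proof.
move cardB: #|B| => k; elim: k B g cardB => [|k IH] B g cardB.
  exists 1; rewrite msize1; split=> // v; rewrite /nat_eval meval1 mul1r.
  by apply: eq_bigr => x _; rewrite (cards0_eq cardB) big_set0.
have /card_gt0P[c cB] : (0 < #|B|)%N by rewrite cardB.
pose B' := B :\ c; have cardB' : #|B'| = k.
  by apply/eqP; rewrite -eqSS -cardB (cardsD1 c B) cB.
have cB' : c \notin B' by rewrite !inE eqxx.
pose S c0 x := (\prod_(b in B') g b (h (x b))) * g c (h (x c0)).
(* Transposing positions [c] and [c0] preserves the count vector and the product over [B']. *)
have swap c0 v : c0 \notin B' -> fiber_sum (S c0) v = fiber_sum (S c) v.
  move=> c0B'; pose sw x : {ffun 'I_theta -> T} := [ffun b => x (tperm c c0 b)].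
  have swK : involutive sw by move=> x; apply/ffunP => b; rewrite !ffunE tpermK.
  rewrite /fiber_sum (reindex_inj (inv_inj swK)).
  apply: eq_big => [x|x _]; first by rewrite count_vec_perm.
  rewrite /S ffunE tpermR; congr (_ * _); apply: eq_bigr => b bB'.
  by rewrite ffunE tpermD //; [apply: contraNneq cB' => ->|apply: contraNneq c0B' => ->].
have inside c0 : c0 \in B' -> fiber_poly k (fiber_sum (S c0)).
  move=> c0B'; pose g' b t := if b == c0 then g b t * g c t else g b t.
  apply: fiber_poly_ext (IH B' g' cardB') => v; apply: eq_bigr => x _.
  rewrite /S (bigD1 c0) // [in RHS](bigD1 c0) //= /g' eqxx -mulrA [RHS]mulrAC.
  rewrite -!mulrA; congr (_ * (_ * _)).
  by apply: eq_bigr => b /andP[_ /negbTE ->].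
(* There are [theta - k] positions outside [B'], [c] among them, so division by this number is
   possible. *)
have theta_gt : (k < theta)%N.
  by rewrite -cardB -[X in (_ <= X)%N]card_ord max_card.
have nz : (theta - k)%:R != 0 :> R by rewrite pnatr_eq0 subn_eq0 -ltnNge.
have mainE v : (theta - k)%:R * fiber_sum (S c) v =
    (g c 0%N * theta%:R + \sum_(i < n) (g c i.+1 - g c 0%N) * (v i)%:R) *
      fiber_sum (fun x => \prod_(b in B') g b (h (x b))) v
    + -1 * \sum_(c0 in B') fiber_sum (S c0) v.
  have -> : (theta - k)%:R * fiber_sum (S c) v =
      \sum_(c0 | c0 \notin B') fiber_sum (S c0) v.
    rewrite (eq_bigr _ (fun c0 => @swap c0 v)) sumr_const mulr_natl.
    have := cardC (mem B'); rewrite cardB' card_ord => E.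
    by rewrite -{1}E addKn; congr (_ *+ _); apply: eq_card => b.
  apply: (addIr (\sum_(c0 in B') fiber_sum (S c0) v)).
  rewrite mulN1r subrK addrC -(bigID (mem B') xpredT) /=.
  rewrite exchange_big big_distrr; apply: eq_bigr => x /eqP <- /=.
  by rewrite -sum_labels -big_distrr mulrC.
have IH0 := IH B' g cardB'.
have F := fiber_polyZ (theta - k)%:R^-1
  (fiber_polyD (fiber_poly_lin (g c 0%N * theta%:R)
                  (fun i : 'I_n => g c i.+1 - g c 0%N) IH0)
    (fiber_polyW (leqnSn k) (fiber_polyZ (-1)
      (fiber_poly_sum (r := index_enum _) (P := mem B')
         (fun c0 _ => @inside c0))))).
apply: fiber_poly_ext F => v /=; rewrite -mainE mulKf //.
by apply: eq_bigr => x _; rewrite (bigD1 c cB) /= mulrC /S;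
   congr (_ * _); apply: eq_bigl => b; rewrite !inE andbC.
Qed.

(** Group the inputs by their labels [s]: the count vector depends on [s] alone, and for given [s]
    the blocks vary independently. *)
Lemma fiber_sum_prod (G : 'I_theta -> T -> R) v :
  fiber_sum (fun x => \prod_b G b (x b)) v =
  \sum_(s : {ffun 'I_theta -> 'I_n.+1} |
      [ffun i : 'I_n => (\sum_b (s b == i.+1 :> nat))%N] == v)
    \prod_b \sum_(y | h y == s b) G b y.
Proof.
pose lab x : {ffun 'I_theta -> 'I_n.+1} := [ffun b => inord (h (x b))].
have labE x b : lab x b = h (x b) :> nat by rewrite ffunE inordK // ltnS.
have countE x : count_vec x = [ffun i : 'I_n => (\sum_b (lab x b == i.+1 :> nat))%N].
  by apply/ffunP => i; rewrite !ffunE; apply: eq_bigr => b _; rewrite labE.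
rewrite /fiber_sum (partition_big lab (fun s =>
   [ffun i : 'I_n => (\sum_b (s b == i.+1 :> nat))%N] == v)) => [|x]; last first.
  by rewrite countE.
apply: eq_bigr => s /eqP cs; rewrite bigA_distr_big_dep; apply: eq_bigl => x.
apply/andP/familyP => [[_ /eqP<-] b|xs]; first by rewrite unfold_in labE.
have labs : lab x = s by apply/ffunP=> b; apply/val_inj; rewrite /= labE; apply/eqP/xs.
by rewrite countE labs cs !eqxx.
Qed.

(** Each factor may be replaced by its mean given the label of its block; outside [B] this mean is
    constant and can be pulled out of the sum. *)
Lemma fiber_poly_prod (B : {set 'I_theta}) (g : 'I_theta -> T -> R) :
  (forall b, b \notin B -> exists c : R, forall t,
     \sum_(y | h y == t) g b y = c * #|[pred y | h y == t]|%:R) ->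
  fiber_poly #|B| (fiber_sum (fun x => \prod_b g b (x b))).
Proof.
move=> flat.
(* For a label that does not occur, division by 0 gives 0, which agrees with the empty sum. *)
pose gbar b t := (\sum_(y | h y == t) g b y) / #|[pred y | h y == t]|%:R.
have condE v : fiber_sum (fun x => \prod_b g b (x b)) v =
    fiber_sum (fun x => \prod_b gbar b (h (x b))) v.
  rewrite fiber_sum_prod (fiber_sum_prod (fun b y => gbar b (h y))).
  apply: eq_bigr => s _; apply: eq_bigr => b _.
  rewrite [RHS](eq_bigr (fun=> gbar b (s b))) => [|y /eqP -> //].
  have -> : \sum_(y | h y == s b) gbar b (s b) =
      gbar b (s b) * #|[pred y | h y == s b]|%:R.
    by rewrite sumr_const mulr_natr; congr (_ *+ _); apply: eq_card.
  have [card0|nz] := eqVneq #|[pred y | h y == s b]| 0%N.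
    by rewrite card0 mulr0 big_pred0 //; apply/card0_eq.
  by rewrite /gbar divfK // pnatr_eq0.
have [c cE] : exists c : 'I_theta -> R, forall b, b \notin B ->
    forall y, gbar b (h y) = c b.
  apply: (@fin_all_exists _ (fun=> R) (fun b c => b \notin B ->
    forall y, gbar b (h y) = c)) => b.
  have [bB|nbB] := boolP (b \in B); first by exists 0.
  have [c cP] := flat b nbB; exists c => _ y.
  rewrite /gbar cP mulfK // pnatr_eq0 -lt0n; apply/card_gt0P; exists y.
  by rewrite inE.
have := fiber_polyZ (\prod_(b | b \notin B) c b) (fiber_poly_prod_label B gbar).
apply: fiber_poly_ext => v; rewrite condE /fiber_sum big_distrr /=.
apply: eq_bigr => x _; rewrite [RHS](bigID (mem B)) /= mulrC; congr (_ * _).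
by apply: eq_bigr => b nbB; rewrite cE.
Qed.

End FiberMoments.

(** The weight is the sum over the blocks of the indicator of a nonzero label, hence at most the
    number of blocks. *)
Lemma weight_count_vec (R : realType) n theta (T : finType) (h : T -> nat)
    (x : {ffun 'I_theta -> T}) :
  (forall y, h y <= n) -> weight (count_vec n h x) <= theta.
Proof.
move=> h_le; rewrite -(ler_nat R) natr_sum.
have := sum_labels h_le (fun t => (t != 0)%:R : R)%R x.
rewrite mul0r add0r; under [in RHS]eq_bigr => i _ do rewrite subr0 mul1r.
move=> <-; rewrite -[X in (_ <= X%:R)%R]card_ord -sumr_const.
by apply: ler_sum => b _; rewrite lern1 leq_b1.
Qed.

(** List label [i.+1] exactly [v i] times and pad with label 0, the default value of [nth], up to
    length [theta]. *)
Lemma count_vec_surj n theta (T : finType) (h : T -> nat) (v : {ffun 'I_n -> nat}) :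
  (forall t, t <= n -> exists y, h y = t) -> weight v <= theta ->
  exists x : {ffun 'I_theta -> T}, count_vec n h x = v.
Proof.
move=> h_surj le_v.
pose s := flatten [seq nseq (v i) i.+1 | i <- enum 'I_n].
have sumS (F : nat -> nat) : \sum_(t <- s) F t = \sum_(i < n) v i * F i.+1.
  rewrite big_flatten big_map big_enum /=; apply: eq_bigr => i _.
  by rewrite big_nseq iter_addn_0 mulnC.
have size_s : size s = weight v.
  by rewrite -sum1_size sumS; apply: eq_bigr => i _; rewrite muln1.
have nth_le b : nth 0 s b <= n.
  have [ltb|geb] := ltnP b (size s); last by rewrite nth_default.
  by have /flatten_mapP[i _ /nseqP[-> _]] := mem_nth 0 ltb.
have [x xE] : exists x : 'I_theta -> T, forall b, h (x b) = nth 0 s b.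
  apply: (@fin_all_exists 'I_theta (fun=> T) (fun b y => h y = nth 0 s b)) => b.
  exact: h_surj.
exists [ffun b => x b]; apply/ffunP => i; rewrite ffunE.
under eq_bigr => b _ do rewrite ffunE xE.
rewrite -(big_mkord xpredT (fun b => (nth 0 s b == i.+1 : nat))).
rewrite (big_cat_nat (leq0n (size s))) ?size_s //= -[in X in X + _]size_s.
rewrite -(big_nth 0 xpredT (fun t => (t == i.+1 : nat))) sumS.
rewrite [X in _ + X]big_nat_cond [X in _ + X]big1 => [|b /andP[/andP[geb _] _]].
  rewrite addn0 (bigD1 i) //= eqxx muln1 big1 ?addn0 // => j nji.
  by rewrite eqSS (negbTE (nji : val j != val i)) muln0.
by rewrite nth_default ?size_s.
Qed.

(** * Cutting the input into blocks *)

Section Blocks.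

Variables m theta : nat.

Lemma block_index_lt (br : 'I_theta * 'I_m) : br.1 * m + br.2 < m * theta.
Proof. by rewrite [X in _ < X]mulnC index_lt. Qed.

Definition block_index (br : 'I_theta * 'I_m) : 'I_(m * theta) :=
  Ordinal (block_index_lt br).

Lemma block_index_div br : block_index br %/ m = br.1.
Proof.
by case: br => b r /=; rewrite divnMDl ?(leq_ltn_trans _ (ltn_ord r)) // divn_small
  // addn0.
Qed.

Lemma block_index_mod br : block_index br %% m = br.2.
Proof. by case: br => b r /=; rewrite modnMDl modn_small. Qed.

Lemma block_index_bij : bijective block_index.
Proof.
apply: inj_card_bij; last by rewrite card_prod !card_ord mulnC.
move=> br1 br2 E; rewrite [br1]surjective_pairing [br2]surjective_pairing.
congr (_, _); apply: val_inj; rewrite /=.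
  by rewrite -!block_index_div E.
by rewrite -!block_index_mod E.
Qed.

Definition blocks (x : cube (m * theta)) : {ffun 'I_theta -> cube m} :=
  [ffun b => [ffun r => x (block_index (b, r))]].

Lemma blocksE x b r : blocks x b r = x (block_index (b, r)).
Proof. by rewrite !ffunE. Qed.

Lemma blocks_bij : bijective blocks.
Proof.
apply: inj_card_bij; last by rewrite !card_ffun card_bool !card_ord expnM.
move=> x1 x2 E; apply/ffunP => j; have [f _ fK] := block_index_bij.
by rewrite -[j]fK [f j]surjective_pairing -!blocksE E.
Qed.

End Blocks.

(** * The surjection *)

Section Construction.

Variables (R : realType) (n theta : nat).
Local Notation L := (clog2 n.+1).
Local Notation m := (6 * clog2 n.+1).

Lemma word_label_le (y : cube m) : word_label y <= n.
Proof. exact: label_le. Qed.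

Definition block_sum (x : cube (inputlen n theta)) : simplex n theta :=
  Sub (count_vec n (@word_label n) (blocks x))
    (weight_count_vec R (blocks x) word_label_le).

Lemma block_sum_surj (v : simplex n theta) : exists x, block_sum x = v.
Proof.
have [z zE] := count_vec_surj (@word_label_surj R n) (valP v).
have [f _ fK] := blocks_bij m theta.
by exists (f z); apply: val_inj; rewrite /= fK.
Qed.

Lemma fiber_sum_blocks (F : {ffun 'I_theta -> cube m} -> R) (v : simplex n theta) :
  (\sum_(x | block_sum x == v) F (blocks x) =
   fiber_sum (@word_label n) F (val v))%R.
Proof.
by rewrite /fiber_sum [RHS](reindex (@blocks m theta)) //; apply/onW_bij/blocks_bij.
Qed.

(** A block in which the monomial has degree above [L] uses up at least [L + 1] of the total degree,
    which bounds the number of such blocks; the factor of any other block has the same mean on all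
    label fibers. *)
Lemma fiber_poly_monomial (mon : 'X_{1..inputlen n theta}) :
  fiber_poly (R := R) (n := n) theta (@word_label n) (mdeg mon %/ (L + 1))
    (fiber_sum (@word_label n) (fun z =>
       \prod_b \prod_(r < m) (z b r)%:R ^+ mon (block_index (b, r))))%R.
Proof.
pose deg (b : 'I_theta) := \sum_(r < m) mon (block_index (b, r)).
have degE : \sum_b deg b = mdeg mon.
  rewrite mdegE (reindex (@block_index m theta)); last exact/onW_bij/block_index_bij.
  by rewrite pair_big; apply: eq_bigr => -[].
pose B := [set b | L < deg b].
apply: (@fiber_polyW _ _ _ _ _ #|B|).
  rewrite leq_divRL ?addn1 // -sum_nat_const -degE [X in _ <= X](bigID (mem B)) /=.
  by apply: leq_trans (leq_addr _ _); apply: leq_sum => b; rewrite inE.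
apply: (fiber_poly_prod word_label_le
  (g := fun b y => (\prod_(r < m) (y r)%:R ^+ mon (block_index (b, r)))%R)) => b.
rewrite inE -leqNgt => le_deg.
(* On bits a positive power equals the variable itself, so only the support of the exponents
   matters. *)
pose S := [set r | mon (block_index (b, r)) != 0].
have leS : #|S| <= L.
  apply: leq_trans le_deg; rewrite -sum1_card big_mkcond; apply: leq_sum => r _.
  by rewrite inE; case: (mon _).
have [c cE] := label_fiber_moment R leS; exists c => t; rewrite -cE.
apply: eq_bigr => y _; rewrite [RHS]big_mkcond; apply: eq_bigr => r _.
rewrite inE; case: (mon _) => [|k]; first by rewrite expr0.
by case: (y r); rewrite ?expr1n // expr0n.
Qed.

(** Linearity reduces the claim to monomials; dividing by the fiber size, nonzero by surjectivity,
    turns the unnormalized identity into one for means. *)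
Lemma block_sum_mean_poly (p : {mpoly R[inputlen n theta]}) :
  exists q : {mpoly R[n]},
    ((tdeg q)%:R <= (tdeg p)%:R / (L + 1)%:R :> R)%R /\
    forall v : simplex n theta,
      fiber_mean block_sum (bool_eval p) v = nat_eval q (val v).
Proof.
have bool_evalE x : bool_eval p x = (\sum_(mon <- msupp p) p@_mon *
    \prod_b \prod_(r < m) (blocks x b r)%:R ^+ mon (block_index (b, r)))%R.
  rewrite /bool_eval mevalE; apply: eq_bigr => mon _; congr (_ * _)%R.
  rewrite (reindex (@block_index m theta)); last exact/onW_bij/block_index_bij.
  rewrite pair_big; apply: eq_bigr => -[b r] _; by rewrite blocksE.
have [q [sq qE]] : fiber_poly (R := R) (n := n) theta (@word_label n) (tdeg p %/ (L + 1))
    (fun v => \sum_(mon <- msupp p) p@_mon * fiber_sum (@word_label n) (fun z =>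
       \prod_b \prod_(r < m) (z b r)%:R ^+ mon (block_index (b, r))) v)%R.
  apply: fiber_poly_sum => mon mon_p _; apply: fiber_polyZ.
  apply: fiber_polyW (fiber_poly_monomial mon); apply: leq_div2r.
  by have := msize_mdeg_lt mon_p; rewrite /tdeg; case: (msize p).
exists q; split.
  have pos : (0 < (L + 1)%:R :> R)%R by rewrite ltr0n addn1.
  rewrite ler_pdivlMr // -natrM ler_nat.
  apply: leq_trans (leq_trunc_div _ (L + 1)); rewrite leq_mul2r; apply/orP; right.
  by rewrite [X in X <= _]/tdeg; case: (msize q) sq.
move=> v; rewrite /fiber_mean.
have sumE : (\sum_(x | block_sum x == v) bool_eval p x =
    nat_eval q (val v) * #|[pred x | block_sum x == v]|%:R)%R.
  have -> : (#|[pred x | block_sum x == v]|%:R =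
      fiber_sum (theta := theta) (@word_label n) (fun=> 1) (val v) :> R)%R.
    by rewrite -fiber_sum_blocks sumr_const; congr (_%:R)%R; apply: eq_card.
  rewrite -qE; under eq_bigr => x _ do rewrite bool_evalE.
  rewrite exchange_big; apply: eq_bigr => mon _.
  by rewrite -big_distrr -fiber_sum_blocks.
rewrite sumE mulfK // pnatr_eq0 -lt0n; apply/card_gt0P.
by have [x <-] := block_sum_surj v; exists x; rewrite inE.
Qed.

(** The bound on [k] guarantees that block [k %/ 2 ^ m] exists; otherwise the term would have no
    literals and be always true. *)
Lemma term_wordP (i : 'I_n) (x : cube (inputlen n theta)) k :
  k < theta * 2 ^ m ->
  term_eval [ffun j : 'I_(inputlen n theta) =>
      literal_of_code (literal_code n i k j)] x =
  [exists b : 'I_theta, (b == k %/ 2 ^ m :> nat) &&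
     [forall r : 'I_m, blocks x b r == bit (term_word n i (k %% 2 ^ m)) r]].
Proof.
move=> ltk; have ltb : k %/ 2 ^ m < theta by rewrite ltn_divLR ?expn_gt0.
apply/forallP/existsP => [xk|[b /andP[/eqP bk /forallP xb]] j].
  exists (Ordinal ltb); rewrite eqxx; apply/forallP => r.
  have := xk (block_index (Ordinal ltb, r)).
  rewrite ffunE /literal_code block_index_div block_index_mod eqxx /= blocksE.
  by case: (bit _ _).
have [f _ fK] := block_index_bij m theta.
rewrite -[j]fK; case: (f j) => b' r.
rewrite ffunE /literal_code block_index_div block_index_mod /= -bk.
have [/val_inj -> /=|//] := eqVneq (b' : nat) b.
by have := xb r; rewrite blocksE; case: (bit _ _).
Qed.

Lemma block_dnfP (i : 'I_n) x :
  dnf_eval (block_dnf theta i) x = ORstar (val (block_sum x) i).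
Proof.
have ORE : ORstar (val (block_sum x) i) =
    [exists b, word_label (blocks x b) == i.+1].
  rewrite /ORstar /= ffunE sum_nat_eq0 negb_forall; apply: eq_existsb => b /=.
  by rewrite eqb0 negbK.
rewrite ORE /dnf_eval /block_dnf /mkseq has_map; apply/hasP/existsP.
  move=> [k]; rewrite mem_iota add0n => /andP[_ ltk] /=; rewrite term_wordP //.
  move=> /existsP[b /andP[_ /forallP xb]]; exists b.
  rewrite -(label_term_word R (k %% 2 ^ m) (ltn_ord i)); apply/eqP/eq_label => r ltr.
  by have := xb (Ordinal ltr) => /eqP <-; rewrite -(bit_num_of_word _ (Ordinal ltr)).
move=> [b /eqP xb]; pose y := num_of_word (blocks x b).
have lty : y < 2 ^ m := sum_pow2_lt _ _.
(* The term for the word actually found in block [b]; its label is [i.+1], so [term_word] keeps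
   it. *)
exists (b * 2 ^ m + y).
  by rewrite mem_iota add0n (index_lt b (Ordinal lty)).
rewrite /= term_wordP; last exact: (index_lt b (Ordinal lty)).
apply/existsP; exists b.
rewrite divnMDl ?expn_gt0 // modnMDl divn_small // modn_small // addn0 eqxx /=.
apply/forallP => r; rewrite /term_word -/(word_label _) xb eqxx.
by rewrite bit_num_of_word.
Qed.

Lemma size_block_dnf (i : 'I_n) :
  size (block_dnf theta i) <= 64 * (theta * n ^ 6).
Proof.
rewrite size_mkseq mulnCA leq_mul2l; apply/orP; right.
have n_gt0 : 0 < n := leq_ltn_trans (leq0n i) (ltn_ord i).
have L_gt0 : 0 < L by rewrite up_log_gt0.
(* From [2 ^ (L - 1) < n + 1] follows [2 ^ L <= 2 * n], whose sixth power yields the constant 64. *)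
rewrite mulnC expnM -[64]/(2 ^ 6) -expnMn leq_exp2r //.
rewrite -(prednK L_gt0) expnS leq_mul2l /=.
rewrite -ltnS; apply: up_log_gtn => //; by rewrite ltnS.
Qed.

Lemma term_vars_block_dnf (i : 'I_n) t :
  t \in block_dnf theta i -> #|term_vars t| <= m.
Proof.
move=> /mapP[k]; rewrite mem_iota add0n => /andP[_ ltk] ->.
have ltb : k %/ 2 ^ m < theta by rewrite ltn_divLR ?expn_gt0.
rewrite -[X in _ <= X]card_ord.
apply: leq_trans (leq_imset_card (fun r : 'I_m => block_index (Ordinal ltb, r)) _).
apply/subset_leq_card/subsetP => j; rewrite inE ffunE.
have [f _ fK] := block_index_bij m theta; rewrite -[j]fK; case: (f j) => b r.
rewrite /literal_code block_index_div block_index_mod /=.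
have [bk _|//] := eqVneq (b : nat) (k %/ 2 ^ m); apply/imsetP; exists r => //.
by have -> : b = Ordinal ltb by apply/val_inj/bk.
Qed.

End Construction.

Theorem theorem3p9 (R : realType) :
  exists (C : nat) (D : forall n theta : nat, 'I_n -> dnf (inputlen n theta)),
    explicitly_given D /\
    forall n theta : nat, 1 <= n -> 1 <= theta ->
    exists G : cube (inputlen n theta) -> simplex n theta,
      (forall v : simplex n theta, exists x, G x = v) /\
      (forall p : {mpoly R[inputlen n theta]},
         exists q : {mpoly R[n]},
           ((tdeg q)%:R <= (tdeg p)%:R / (clog2 n.+1 + 1)%:R :> R)%R /\
           forall v : simplex n theta,
             fiber_mean G (bool_eval p) v = nat_eval q (val v)) /\
      (forall i : 'I_n,
         [/\ forall x, dnf_eval (D n theta i) x = ORstar (val (G x) i),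
             size (D n theta i) <= C * (theta * n ^ 6)
           & forall t, t \in D n theta i ->
               #|term_vars t| <= 6 * clog2 n.+1]).
Proof.
exists 64, block_dnf; split; first exact: block_dnf_explicit.
move=> n theta _ _; exists (@block_sum R n theta); split; last split.
- exact: block_sum_surj.
- exact: block_sum_mean_poly.
move=> i; split; [exact: block_dnfP|exact: size_block_dnf|].
exact: term_vars_block_dnf.
Qed.
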